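(* For all $d\ge1$ and $1\le l\le d$, the polynomial $B_l(d,t)=\sum_{k=0}^dh_kt^k$ has only real roots and is alternatingly increasing, i.e. $h_0\le h_d\le h_1\le h_{d-1}\le\cdots\le h_{\lfloor\frac{d+1}{2}\rfloor}$.
   Context: A signed permutation of $[d]$ is a pair $(\sigma,\epsilon)$ with $\sigma\in S_d$, $\epsilon\in\{\pm1\}^d$; $B_d$ is the set of these. Set $\sigma_0=0$, $\epsilon_0=1$. The descent number is $\operatorname{des}(\sigma,\epsilon)=|\{i\in\{0,\dots,d-1\}:\epsilon_i\sigma_i>\epsilon_{i+1}\sigma_{i+1}\}|$. For $1\le l\le d$, $B_l(d,t)=\sum t^{\operatorname{des}(\sigma,\epsilon)}$, the sum over $(\sigma,\epsilon)\in B_d$ with $\epsilon_d\sigma_d=d+1-l$.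
   Formalization: Since the last letter is positive, B_l(d,t) has degree exactly d−1, so h_d=0 and the chain as written fails (d=l=1: B=1, h_0=1>h_1=0); the chain is proved with the degree d−1 in place of d: h_0≤h_{d−1}≤h_1≤h_{d−2}≤⋯≤h_{⌊d/2⌋}. *)

(* Defs.v *)
From mathcomp Require Import all_boot all_order all_fingroup all_algebra.
From mathcomp Require Import reals.
From mathcomp Require Import complex.

Set Implicit Arguments.
Unset Strict Implicit.
Unset Printing Implicit Defensive.

Import Order.TTheory GRing.Theory Num.Theory.
Local Open Scope ring_scope.

(* Signed permutations of [d], 0-indexed: [w.1 i] stands for sigma_(i+1) - 1,
   and [w.2 i = true] means that the sign epsilon_(i+1) is -1. *)
Notation sperm d := ('S_d * {ffun 'I_d -> bool})%type.

(* epsilon_i * sigma_i for 0 <= i <= d, with value 0 at i = 0; for i > 0,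
   [unlift ord0 i = Some j] with i = j + 1. *)
Definition sperm_val (d : nat) (w : sperm d) (i : 'I_d.+1) : int :=
  if unlift ord0 i is Some j then (-1) ^+ w.2 j * (w.1 j).+1%:Z else 0.

(* For i : 'I_d, [widen_ord (leqnSn d) i] and [lift ord0 i] are i and i + 1
   in 'I_d.+1. *)
Definition des (d : nat) (w : sperm d) : nat :=
  #|[set i : 'I_d |
      sperm_val w (widen_ord (leqnSn d) i) > sperm_val w (lift ord0 i)]|.

Definition Bpoly (l d : nat) : {poly int} :=
  \sum_(w : sperm d | sperm_val w ord_max == (d.+1 - l)%:Z) 'X^(des w).

Definition real_rooted (p : {poly int}) : Prop :=
  forall (R : realType) (z : R[i]),
    root (map_poly intr p) z -> z \is Num.real.

(* The sequence 0, n, 1, n - 1, 2, ...; its term of index n is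
   floor((n + 1) / 2). *)
Definition alt_index (n j : nat) : nat :=
  if odd j then (n - j./2)%N else j./2.

(* h_0 <= h_n <= h_1 <= h_(n-1) <= ... <= h_(floor((n+1)/2)), where n is the
   degree of p. *)
Definition alternatingly_increasing (p : {poly int}) : Prop :=
  let n := (size p).-1 in
  forall j : nat, (j < n)%N -> p`_(alt_index n j) <= p`_(alt_index n j.+1).

Lemma des_lt (d : nat) (w : sperm d) : 0 < sperm_val w ord_max -> (des w < d)%N.
Proof.
move=> wd; rewrite ltn_neqAle andbC -[X in (_ <= X)%N]card_ord max_card /=.
apply: contraTN wd => /eqP Dw; rewrite -leNgt.
have all_des (i : 'I_d) :
  sperm_val w (lift ord0 i) < sperm_val w (widen_ord (leqnSn d) i).
  have: i \in [set i : 'I_d |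
      sperm_val w (widen_ord (leqnSn d) i) > sperm_val w (lift ord0 i)].
    suff -> : [set i : 'I_d | sperm_val w (widen_ord (leqnSn d) i)
         > sperm_val w (lift ord0 i)] = setT by rewrite inE.
    by apply/eqP; rewrite eqEcard subsetT cardsT card_ord -[X in (X <= _)%N]Dw /=.
  by rewrite inE.
suff val_le0 k (lt_kd : (k < d.+1)%N) : sperm_val w (Ordinal lt_kd) <= 0.
  by have := val_le0 d (ltnSn d); congr (sperm_val w _ <= 0); apply: val_inj.
elim: k lt_kd => [|k IHk] lt_kd.
  have -> : Ordinal lt_kd = ord0 by apply: val_inj.
  by rewrite /sperm_val unlift_none.
have lt_k : (k < d)%N by [].
have := all_des (Ordinal lt_k).
have -> : lift ord0 (Ordinal lt_k) = Ordinal lt_kd by apply: val_inj.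
move/ltW/le_trans; apply.
have lt_k' : (k < d.+1)%N by apply: leqW.
have -> : widen_ord (leqnSn d) (Ordinal lt_k) = Ordinal lt_k' by apply: val_inj.
exact: IHk.
Qed.

(* B_l(d,t) has degree d - 1 for 1 <= l <= d: a signed permutation with
   epsilon_d * sigma_d > 0 cannot have d descents.  So for [Bpoly l d] the chain
   in [alternatingly_increasing] runs over h_0, ..., h_(d-1).  Ending it at the
   vanishing coefficient h_d instead would make it false, e.g. B_1(1,t) = 1. *)
Lemma size_Bpoly (l d : nat) : (1 <= l <= d)%N -> size (Bpoly l d) = d.
Proof.
case: d => [|n] /andP[l1 ld]; first by case: l l1 ld.
have m_gt0 : 0 < (n.+2 - l)%:Z by rewrite ltz_nat subn_gt0 ltnS.
apply/eqP; rewrite eqn_leq; apply/andP; split.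
  apply: (leq_trans (size_sum _ _ _)); apply/bigmax_leqP => w /eqP wm.
  by rewrite size_polyXn des_lt // wm.
rewrite ltnNge; apply/negP => /leq_sizeP/(_ n (leqnn n))/eqP.
rewrite /Bpoly coef_sum; apply/negP/lt0r_neq0.
have lt_m : (n.+1 - l < n.+1)%N by rewrite ltn_subrL l1.
pose m := Ordinal lt_m.
pose w : sperm n.+1 :=
  (lift_perm ord_max m 1%g, [ffun i : 'I_n.+1 => i != ord_max]).
have wS (j : 'I_n.+1) :
    sperm_val w (lift ord0 j) = (-1) ^+ (j != ord_max) * (w.1 j).+1%:Z.
  by rewrite /sperm_val liftK /= ffunE.
have ordmaxE : ord_max = lift ord0 (ord_max : 'I_n.+1) by apply: val_inj.
have w_last : sperm_val w ord_max == (n.+2 - l)%:Z.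
  by rewrite ordmaxE wS eqxx mul1r /= lift_perm_id /= -subSn.
rewrite (bigD1 w) //= ltr_pwDl //; last first.
  by apply: sumr_ge0 => v _; rewrite coefXn ler0n.
suff -> : des w = n by rewrite coefXn eqxx.
apply/eqP; rewrite eqn_leq; apply/andP; split.
  by rewrite -ltnS des_lt // (eqP w_last).
have wneg (j : 'I_n) : sperm_val w (lift ord0 (lift ord_max j))
    = - (bump m j).+1%:Z.
  by rewrite wS eq_sym neq_lift mulN1r /= lift_perm_lift perm1.
rewrite -[X in (X <= _)%N]card_ord -(card_imset _ (@lift_inj _ (ord_max : 'I_n.+1))).
apply/subset_leq_card/subsetP => _ /imsetP[j _ ->]; rewrite inE wneg.
case: j => -[|k] lt_k.
  have -> : widen_ord (leqnSn n.+1) (lift ord_max (Ordinal lt_k)) = ord0.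
    by apply: val_inj; rewrite /= /bump leqNgt lt_k.
  by rewrite [ltRHS]/sperm_val unlift_none oppr_lt0.
have lt_k' : (k < n)%N by apply: ltnW.
have -> : widen_ord (leqnSn n.+1) (lift ord_max (Ordinal lt_k))
  = lift ord0 (lift ord_max (Ordinal lt_k')).
  by apply: val_inj; rewrite /= /bump leqNgt lt_k [(n <= k)%N]leqNgt lt_k'.
rewrite wneg ltrN2 ltz_nat ltnS /bump /= -addnS leq_add //.
by case: (leqP (n.+1 - l) k) => // /leqW ->.
Qed.

(* Main.v *)
(** Let f_v be the sum of t^des over the signed permutations of [d] with last
value v, for v in -d, ..., -1, 1, ..., d.  Deleting the last letter expresses
each f_v for d + 1 as a sum of the polynomials for d, where those whose index
exceeds v carry an extra factor t.

Alternating increase: list all the coefficients of the f_v, ordered by degree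
and then by v.  The recurrence says that the list for d + 1 is made of the sums
of 2d consecutive terms of the list for d, every d-th of these sums being
repeated, so by induction the list is symmetric and unimodal.  For v > 0 the
required inequalities compare terms of this list.

Real roots: the same recurrence yields, for f_v at d and for S = f_d at d,
    f_v at d + 1       = 2t((1 - t) f_v' + d f_v),
    f_(d+1) at d + 1   = 2t(1 - t) S' + (2(d - 1)t + 1 + t) S.
At the roots of f_v (resp. t S), the factor (1 - t) f_v' + d f_v (resp. the
second right-hand side) is a positive multiple of the derivative of f_v (resp.
t S).  So its signs alternate there and, counting its sign at -oo, produce as
many roots as its degree, all simple and negative. *)
Require Import Defs.
From mathcomp Require Import all_boot all_order all_fingroup all_algebra.
From mathcomp Require Import reals complex polyrcf.
From mathcomp Require Import zify ring.

Set Implicit Arguments.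
Unset Strict Implicit.
Unset Printing Implicit Defensive.

Import Order.TTheory GRing.Theory Num.Theory.

Section SimplySplit.
Local Open Scope ring_scope.
Variable R : rcfType.
Implicit Types (p q : {poly R}) (s t : seq R) (D : pred R) (a b x y : R).

Local Notation prod_XsubC s := (\prod_(r <- s) ('X - r%:P)).

Definition simply_split D p : Prop :=
  exists s, [/\ sorted <%R s, all D s & p = lead_coef p *: prod_XsubC s].

Lemma simply_split_sub D D' p :
  subpred D D' -> simply_split D p -> simply_split D' p.
Proof. by move=> sDD' [s [sort_s /(sub_all sDD') D's def_p]]; exists s. Qed.

Lemma root_simply_split D p x :
  p != 0 -> simply_split D p -> root p x -> D x.
Proof.
rewrite -lead_coef_eq0 => p_neq0 [s [_ /allP Ds ->]].
by rewrite rootZ // root_prod_XsubC => /Ds.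
Qed.

Lemma simply_split_complex_root D p (z : R[i]) :
    p != 0 -> simply_split D p -> root (map_poly (real_complex R) p) z ->
  z \is Num.real.
Proof.
rewrite -lead_coef_eq0 => p_neq0 [s [_ _ ->]].
rewrite map_polyZ rootZ ?fmorph_eq0 // rmorph_prod /=.
under eq_bigr do rewrite map_polyXsubC.
rewrite -(big_map (real_complex R) xpredT (fun c => 'X - c%:P)).
by rewrite root_prod_XsubC => /mapP[x _ ->]; rewrite complex_real.
Qed.

Lemma simply_split_mul_XsubC b p :
  simply_split (< b) p -> simply_split (<= b) (p * ('X - b%:P)).
Proof.
move=> [s [sort_s lt_b def_p]]; exists (rcons s b); split.
- by rewrite lt_sorted_pairwise pairwise_rcons lt_b -lt_sorted_pairwise.
- by rewrite all_rcons /= lexx; apply: sub_all lt_b => x /ltW.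
- by rewrite lead_coef_Mmonic ?monicXsubC // big_rcons /= scalerAl -def_p.
Qed.

Lemma simply_splitZ D p a :
  a != 0 -> simply_split D p -> simply_split D (a *: p).
Proof.
move=> a_neq0 [s [sort_s Ds def_p]]; exists s; split=> //.
by rewrite lead_coefZ -scalerA -def_p.
Qed.

Lemma sgr_horner_prod_XsubC s x :
  all (> x) s -> Num.sg (prod_XsubC s).[x] = (-1) ^+ size s.
Proof.
elim: s => [|y s IHs] /=; first by rewrite big_nil hornerC sgr1.
move=> /andP[lt_xy /IHs IHx].
by rewrite big_cons hornerM sgrM IHx hornerXsubC ltr0_sg ?subr_lt0 // exprS.
Qed.

Lemma horner_deriv_mul_XsubC p x : (('X - x%:P) * p)^`().[x] = p.[x].
Proof. by rewrite derivM derivXsubC !hornerE subrr mul0r addr0. Qed.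

Lemma sgr_deriv_mul_XsubC p x a : root p a -> x < a ->
  Num.sg (('X - x%:P) * p)^`().[a] = Num.sg p^`().[a].
Proof.
move=> /rootP pa0 lt_xa; rewrite derivM derivXsubC !hornerE pa0 add0r sgrM.
by rewrite gtr0_sg ?mul1r // subr_gt0.
Qed.

Definition sign_change p : rel R :=
  [rel a b | (a < b) && (p.[a] * p.[b] < 0)].

Lemma sign_change_sgr p q a b :
    Num.sg p.[a] = Num.sg q.[a] -> Num.sg p.[b] = Num.sg q.[b] ->
  sign_change p a b = sign_change q a b.
Proof.
move=> sg_a sg_b; rewrite /sign_change /=.
by rewrite -[_ * _ < 0]sgr_lt0 -[in RHS]sgr_lt0 !sgrM sg_a sg_b.
Qed.

Lemma deriv_prod_XsubC_sign_change x s : path <%R x s ->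
  path (sign_change (prod_XsubC (x :: s))^`()) x s.
Proof.
elim: s x => //= y s IHs x /andP[lt_xy path_s].
have gt_y := order_path_min lt_trans path_s.
have gt_x : all (> x) (y :: s).
  by rewrite /= lt_xy; apply: sub_all gt_y => z; apply: lt_trans.
have root_s z : z \in y :: s -> root (prod_XsubC (y :: s)) z.
  by rewrite root_prod_XsubC.
rewrite [prod_XsubC (x :: _)]big_cons; apply/andP; split.
  rewrite /sign_change /= lt_xy /= -sgr_lt0 sgrM horner_deriv_mul_XsubC.
  rewrite sgr_deriv_mul_XsubC ?root_s ?mem_head // (sgr_horner_prod_XsubC gt_x).
  rewrite big_cons horner_deriv_mul_XsubC (sgr_horner_prod_XsubC gt_y) /=.
  by rewrite exprS mulN1r mulNr -expr2 sqrr_sign oppr_lt0.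
apply: sub_in_path (IHs y path_s) => [a b a_s b_s|]; last exact: allss.
by rewrite (@sign_change_sgr _ (('X - x%:P) * prod_XsubC (y :: s))^`()) //;
  rewrite sgr_deriv_mul_XsubC ?root_s //; apply: (allP gt_x).
Qed.

Lemma sign_change_roots q x s : path (sign_change q) x s ->
  exists t, [/\ size t = size s, path <%R x t, all (root q) t &
                all (< last x s) t].
Proof.
elim: s x => [|y s IHs] x /=; first by exists [::].
move=> /andP[/andP[lt_xy alt] path_s].
have [t [size_t path_t root_t lt_t]] := IHs y path_s.
have [z /[!in_itv]/= /andP[lt_xz lt_zy] qz] := poly_ivtoo (ltW lt_xy) alt.
have y_last : y <= last y s.
  have lt_s : path <%R y s by apply: sub_path path_s => a b /andP[].
  have := mem_last y s; rewrite inE => /predU1P[->//|].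
  by move/(allP (order_path_min lt_trans lt_s))/ltW.
exists (z :: t); rewrite /= size_t lt_xz qz root_t lt_t !andbT; split=> //.
  exact: (path_le lt_trans lt_zy).
exact: lt_le_trans y_last.
Qed.

Lemma same_sgr_minfty p q :
    p != 0 -> size q = size p -> Num.sg (lead_coef q) = Num.sg (lead_coef p) ->
  exists2 x, (forall r, root p r -> x < r) & Num.sg q.[x] = Num.sg p.[x].
Proof.
move=> p_neq0 size_qp sgr_lc.
have q_neq0 : q != 0 by rewrite -size_poly_eq0 size_qp size_poly_eq0.
exists (Num.min (- cauchy_bound q) (- cauchy_bound p)).
  move=> r /(root_in_cauchy_bound p_neq0)/[!in_itv]/= /andP[lt_r _].
  by rewrite gt_min lt_r orbT.
rewrite (sgp_minftyP (le_cauchy_bound q_neq0)); last first.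
  by rewrite in_itv /= ge_min lexx.
rewrite (sgp_minftyP (le_cauchy_bound p_neq0)); last first.
  by rewrite in_itv /= ge_min lexx orbT.
by rewrite /sgp_minfty !sgrM size_qp sgr_lc.
Qed.

(* Together with its sign at -oo, the signs of [q] at the roots of [p] force
   [(size p).-1] sign changes, hence as many roots. *)
Lemma simply_split_deriv_sgr p q b :
    simply_split (<= b) p -> 0 < lead_coef p -> 0 < lead_coef q ->
    size q = size p ->
    (forall r, root p r -> r <= b -> Num.sg q.[r] = Num.sg p^`().[r]) ->
  simply_split (< b) q.
Proof.
move=> [s [sort_s le_b def_p]] lc_p lc_q size_qp sgr_q.
have p_neq0 : p != 0 by rewrite -lead_coef_eq0 gt_eqF.
have root_s r : r \in s -> root p r.
  by rewrite def_p rootZ ?gt_eqF // root_prod_XsubC.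
have sgr_lc : Num.sg (lead_coef q) = Num.sg (lead_coef p) by rewrite !gtr0_sg.
have [x gt_x sgr_qx] := same_sgr_minfty p_neq0 size_qp sgr_lc.
have path_s : path <%R x s.
  by rewrite path_min_sorted //; apply/allP => r /root_s/gt_x.
have sgr_qE y : y \in x :: s ->
    Num.sg q.[y] = Num.sg (prod_XsubC (x :: s))^`().[y].
  rewrite inE big_cons => /predU1P[->|y_s].
    by rewrite horner_deriv_mul_XsubC sgr_qx def_p hornerZ sgrM gtr0_sg ?mul1r.
  rewrite sgr_deriv_mul_XsubC ?root_prod_XsubC ?gt_x ?root_s //.
  rewrite (sgr_q y (root_s y y_s) (allP le_b y y_s)) def_p derivZ hornerZ.
  by rewrite sgrM gtr0_sg ?mul1r.
have [|t [size_t path_t root_t lt_t]] := @sign_change_roots q x s.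
  apply: sub_in_path (deriv_prod_XsubC_sign_change path_s); last exact: allss.
  move=> y z /sgr_qE sgr_qy /sgr_qE sgr_qz.
  by rewrite (sign_change_sgr sgr_qy sgr_qz).
have sort_t := path_sorted path_t.
exists t; split=> //.
  case: (s) le_b size_t lt_t => [_ /size0nil->//|y u /allP le_b _].
  by apply: sub_all => z /lt_le_trans; apply; apply: le_b (mem_last y u).
apply: all_roots_prod_XsubC => //.
  by rewrite size_qp def_p size_scale ?gt_eqF // size_prod_XsubC size_t.
by rewrite uniq_rootsE; apply: (sorted_uniq lt_trans ltxx).
Qed.
End SimplySplit.

Section SymmetricUnimodal.
Local Open Scope ring_scope.
Variable R : numDomainType.
Implicit Types (H : int -> R) (P x y : int) (m n : nat).

Definition symmetric_unimodal P H : Prop :=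
  (forall x, H (P - x) = H x) /\
  (forall x y, x <= y -> x + y <= P -> H x <= H y).

Lemma eq_symmetric_unimodal P H H' :
  H =1 H' -> symmetric_unimodal P H -> symmetric_unimodal P H'.
Proof. by move=> eqH [Hsym Hmono]; split=> *; rewrite -!eqH ?Hsym ?Hmono. Qed.

Lemma symmetric_unimodal_step P H :
    (forall x, H (P - x) = H x) ->
    (forall x, x + x + 1 <= P -> H x <= H (x + 1)) ->
  symmetric_unimodal P H.
Proof.
move=> Hsym Hstep; split=> // x y le_xy le_P.
have up n : (x + n%:Z) *+ 2 <= P + 1 -> H x <= H (x + n%:Z).
  elim: n => [|n IHn] le_n; first by rewrite addr0.
  apply: (le_trans (IHn _)); first by lia.
  have -> : x + n.+1%:Z = x + n%:Z + 1 by lia.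
  by apply: Hstep; lia.
have [le_y|lt_y] := lerP (y *+ 2) P.
  have -> : y = x + (absz (y - x)%R)%:Z by lia.
  by apply: up; lia.
rewrite -(Hsym y); have -> : P - y = x + (absz (P - y - x)%R)%:Z by lia.
by apply: up; lia.
Qed.

Definition window_sum n H x : R := \sum_(i < n) H (x - 1 - i%:Z).

Lemma window_sum_slide n H x :
  window_sum n H (x + 1) + H (x - n%:Z) = H x + window_sum n H x.
Proof.
transitivity (\sum_(i < n.+1) H (x - i%:Z)).
  rewrite big_ord_recr /=; congr (_ + _).
  by apply: eq_bigr => i _; congr H; lia.
rewrite big_ord_recl subr0; congr (_ + _).
by apply: eq_bigr => i _; congr H; rewrite /= /bump; lia.
Qed.

Lemma symmetric_unimodal_window_sum n P H :
  symmetric_unimodal P H -> symmetric_unimodal (P + n%:Z + 1) (window_sum n H).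
Proof.
move=> [Hsym Hmono]; apply: symmetric_unimodal_step => x.
  rewrite /window_sum (reindex_inj rev_ord_inj); apply: eq_bigr => i _ /=.
  by rewrite -Hsym; congr H; have := ltn_ord i; lia.
move=> le_x; rewrite -(lerD2r (H (x - n%:Z))) window_sum_slide addrC lerD2r.
by apply: Hmono; lia.
Qed.

Lemma window_sum_split n m H y : (m <= n)%N ->
  window_sum n H (y + m%:Z) =
  \sum_(s < n) H (y + s%:Z - ((m <= s) * n)%N%:Z).
Proof.
move=> le_mn; rewrite /window_sum.
rewrite -(big_mkord xpredT (fun i => H (y + m%:Z - 1 - i%:Z))).
rewrite -(big_mkord xpredT (fun s => H (y + s%:Z - ((m <= s) * n)%N%:Z))).
rewrite !(big_cat_nat (leq0n m) le_mn) /=; congr (_ + _).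
  rewrite big_nat_rev; apply: eq_big_nat => i /andP[_ lt_i].
  by rewrite leqNgt lt_i; congr H; lia.
rewrite big_nat_rev; apply: eq_big_nat => i /andP[le_i lt_i].
by rewrite le_i; congr H; lia.
Qed.

(* [H \o stutter m] is [H] with each term whose index is a multiple of [m - 1]
   repeated. *)
Definition stutter m x : int := x - (x %/ m)%Z.

Lemma stutter_rev m j x : (0 < m)%N ->
  stutter m (j * m%:Z - 1 - x) = j * (m%:Z - 1) - stutter m x.
Proof.
move=> m_gt0; have m_neq0 : m%:Z != 0 by lia.
rewrite /stutter.
have := divz_eq x m; set q := (x %/ m)%Z; set r := (x %% m)%Z => x_eq.
have r_ge0 : 0 <= r := modz_ge0 x m_neq0.
have r_lt : r < m%:Z by rewrite ltz_pmod.
have -> : j * m%:Z - 1 - x = (j - 1 - q) * m%:Z + (m%:Z - 1 - r) by lia.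
by rewrite divzMDl // divz_small; lia.
Qed.

Lemma stutter_le m : (0 < m)%N -> {homo stutter m : x y / x <= y}.
Proof.
move=> m_gt0 x y le_xy; have m_neq0 : m%:Z != 0 by lia.
have : (y %/ m)%Z <= (((y - x) * m%:Z + x) %/ m)%Z by apply: lez_pdiv2r; nia.
by rewrite divzMDl // /stutter; lia.
Qed.

Lemma symmetric_unimodal_stutter m (j : int) H : (0 < m)%N ->
    symmetric_unimodal (j * (m%:Z - 1)) H ->
  symmetric_unimodal (j * m%:Z - 1) (H \o stutter m).
Proof.
move=> m_gt0 [Hsym Hmono]; split=> [x|x y le_xy le_P] /=.
  by rewrite stutter_rev ?Hsym.
apply: Hmono; first exact: stutter_le.
by rewrite -lerBrDl -stutter_rev // stutter_le // lerBrDl.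
Qed.
End SymmetricUnimodal.

Section LastLetter.
Local Open Scope ring_scope.
Implicit Types (d l m n r s : nat) (b : bool) (x y : int).

Definition letter_val b n : int := if b then Negz n else n.+1%:Z.

Lemma letter_val_inj b b' m n :
  letter_val b m = letter_val b' n -> b = b' /\ m = n.
Proof. by case: b; case: b' => //= -[->]. Qed.

Lemma sperm_val0 d (w : sperm d) : sperm_val w ord0 = 0.
Proof. by rewrite /sperm_val unlift_none. Qed.

Lemma sperm_val_lift d (w : sperm d) (j : 'I_d) :
  sperm_val w (lift ord0 j) = letter_val (w.2 j) (w.1 j).
Proof.
by rewrite /sperm_val liftK /letter_val; case: (w.2 j); rewrite ?mulN1r ?mul1r.
Qed.

Lemma sperm_val_max d (w : sperm d.+1) :
  sperm_val w ord_max = letter_val (w.2 ord_max) (w.1 ord_max).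
Proof. by rewrite -sperm_val_lift; congr sperm_val; apply: val_inj. Qed.

Lemma des_sum d (w : sperm d) :
  des w = (\sum_(i < d) (sperm_val w (lift ord0 i) <
                         sperm_val w (widen_ord (leqnSn d) i))%R)%N.
Proof. by rewrite /des cardsE -sum1_card big_mkcond. Qed.

(* The increasing map from [int] to the integers other than m + 1 and -(m + 1)
   that fixes 0. *)
Definition bumpz m x : int :=
  x + (m.+1%:Z <= x)%R%:Z - (x <= - m.+1%:Z)%R%:Z.

Lemma bumpz_lt m x y : (bumpz m x < bumpz m y) = (x < y).
Proof. by rewrite /bumpz; lia. Qed.

Lemma bumpz_letter_val m b n :
  bumpz m (letter_val b n) = letter_val b (bump m n).
Proof. by case: b; rewrite /bumpz /bump /=; lia. Qed.

Definition sperm_rcons d (m : 'I_d.+1) b (w : sperm d) : sperm d.+1 :=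
  (lift_perm ord_max m w.1,
   [ffun i => if unlift ord_max i is Some j then w.2 j else b]).

Lemma sperm_rcons_max d (m : 'I_d.+1) b (w : sperm d) :
  sperm_val (sperm_rcons m b w) ord_max = letter_val b m.
Proof. by rewrite sperm_val_max /= lift_perm_id ffunE unlift_none. Qed.

Lemma sperm_rcons_widen d (m : 'I_d.+1) b (w : sperm d) (i : 'I_d.+1) :
  sperm_val (sperm_rcons m b w) (widen_ord (leqnSn d.+1) i) =
  bumpz m (sperm_val w i).
Proof.
case: (unliftP ord0 i) => [j|] ->.
  have -> : widen_ord (leqnSn d.+1) (lift ord0 j) = lift ord0 (lift ord_max j).
    by apply: val_inj; rewrite /= !/bump /= leqNgt ltn_ord.
  by rewrite !sperm_val_lift /= lift_perm_lift ffunE liftK bumpz_letter_val.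
have -> : widen_ord (leqnSn d.+1) ord0 = ord0 by apply: val_inj.
by rewrite !sperm_val0.
Qed.

Lemma sperm_rcons_bij d :
  bijective (fun u : ('I_d.+1 * bool) * sperm d => sperm_rcons u.1.1 u.1.2 u.2).
Proof.
apply: inj_card_bij; last first.
  rewrite !card_prod !card_ffun card_Sn card_bool !card_ord card_Sn.
  by rewrite factS expnS; lia.
move=> [[m b] [s e]] [[m' b'] [s' e']] /= E.
have := congr1 (fun w => sperm_val w ord_max) E.
rewrite !sperm_rcons_max => /letter_val_inj[<- /val_inj Em].
rewrite -{m'}Em in E *; case: E => /permP Es /ffunP Ee; congr (_, (_, _)).
  apply/permP => j; apply: (@lift_inj _ m).
  by rewrite -!(lift_perm_lift ord_max) Es.
by apply/ffunP => j; have := Ee (lift ord_max j); rewrite !ffunE liftK.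
Qed.

Lemma des_sperm_rcons d (m : 'I_d.+1) b (w : sperm d) :
  des (sperm_rcons m b w) =
  (des w + (letter_val b m < bumpz m (sperm_val w ord_max))%R)%N.
Proof.
rewrite !des_sum big_ord_recr /=; congr (_ + nat_of_bool _)%N.
  apply: eq_bigr => i _; rewrite sperm_rcons_widen.
  have -> : lift ord0 (widen_ord (leqnSn d) i) =
            widen_ord (leqnSn d.+1) (lift ord0 i) by apply: val_inj.
  by rewrite sperm_rcons_widen bumpz_lt.
rewrite sperm_rcons_widen -(sperm_rcons_max m b w).
by congr (sperm_val _ _ < _); apply: val_inj.
Qed.

Definition Bpoly_last d x : {poly int} :=
  \sum_(w : sperm d | sperm_val w ord_max == x) 'X^(des w).

Lemma Bpoly_lastS d (m : 'I_d.+1) b :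
  Bpoly_last d.+1 (letter_val b m) =
  \sum_(w : sperm d)
    'X^((letter_val b m < bumpz m (sperm_val w ord_max))%R : nat) * 'X^(des w).
Proof.
rewrite /Bpoly_last (reindex _ (onW_bij _ (sperm_rcons_bij d))) /=.
have last_letterE (u : ('I_d.+1 * bool) * sperm d) :
    (sperm_val (sperm_rcons u.1.1 u.1.2 u.2) ord_max == letter_val b m) =
    (u.1 == (m, b)) && true.
  case: u => [[m' b'] w]; rewrite sperm_rcons_max andbT /=.
  by apply/eqP/eqP => [/letter_val_inj[-> /val_inj->]|[-> ->]].
rewrite (eq_bigl _ _ last_letterE).
rewrite -(pair_big_dep (pred1 (m, b)) (fun _ _ => true)
  (fun u w => 'X^(des (sperm_rcons u.1 u.2 w)))) big_pred1_eq.
by apply: eq_bigr => w _; rewrite des_sperm_rcons exprD mulrC.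
Qed.

(* The nonzero integers of absolute value at most [d], listed increasingly. *)
Definition rank_val d r : int := r%:Z - d%:Z + (d <= r)%N%:Z.

Lemma rank_val_inj d : injective (rank_val d).
Proof. by move=> r s; rewrite /rank_val; lia. Qed.

Lemma rank_val_letter d r : (r < d.*2)%N ->
  exists (m : 'I_d) b, rank_val d r = letter_val b m.
Proof.
move=> lt_r; have lt_m : ((if r < d then d.-1 - r else r - d) < d)%N.
  by case: (ltnP r d); lia.
exists (Ordinal lt_m), (r < d)%N; rewrite /rank_val /letter_val /=.
by case: (ltnP r d); lia.
Qed.

Lemma letter_val_rank d (m : 'I_d) b :
  exists s : 'I_d.*2, letter_val b m = rank_val d s.
Proof.
have lt_s : ((if b then d.-1 - m else d + m) < d.*2)%N.
  by have := ltn_ord m; case: b; lia.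
exists (Ordinal lt_s); have := ltn_ord m.
by case: b lt_s; rewrite /rank_val /=; lia.
Qed.

(* Among the nonzero integers of absolute value at most [d.+1] other than the
   one of rank [r] and its opposite, the number of those below it. *)
Definition rank_shift d r : nat := r - (d < r).

Lemma rank_shift_le d r : (r < d.+1.*2)%N -> (rank_shift d r <= d.*2)%N.
Proof. by rewrite /rank_shift; lia. Qed.

Lemma rank_val_lt_bumpz d m b r s :
    letter_val b m = rank_val d.+1 r ->
  (rank_val d.+1 r < bumpz m (rank_val d s)) = (rank_shift d r <= s)%N.
Proof.
by rewrite /rank_shift /bumpz /rank_val; case: b => /=; lia.
Qed.

Definition Bpoly_rank d r : {poly int} := Bpoly_last d (rank_val d r).

Lemma Bpoly_rankE l d : (0 < l <= d)%N -> Bpoly l d = Bpoly_rank d (d.*2 - l).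
Proof.
move=> ld; rewrite /Bpoly_rank.
by have -> : rank_val d (d.*2 - l) = (d.+1 - l)%:Z by rewrite /rank_val; lia.
Qed.

Lemma size_Bpoly_rank d r : (d <= r < d.*2)%N -> size (Bpoly_rank d r) = d.
Proof.
move=> dr; have -> : r = (d.*2 - (d.*2 - r))%N by lia.
by rewrite -Bpoly_rankE ?size_Bpoly //; lia.
Qed.

Lemma lead_coef_Bpoly_rank_gt0 d r :
  (d <= r < d.*2)%N -> 0 < lead_coef (Bpoly_rank d r).
Proof.
move=> dr; rewrite lt_def lead_coef_eq0 -size_poly_eq0 size_Bpoly_rank //.
apply/andP; split; first by lia.
rewrite lead_coefE /Bpoly_rank /Bpoly_last coef_sum; apply: sumr_ge0 => w _.
by rewrite coefXn ler0n.
Qed.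

Lemma Bpoly_rankS d r : (0 < d)%N -> (r < d.+1.*2)%N ->
  Bpoly_rank d.+1 r =
  \sum_(s < d.*2) 'X^(rank_shift d r <= s) * Bpoly_rank d s.
Proof.
case: d => // d _ lt_r; have [m [b def_r]] := rank_val_letter lt_r.
rewrite /Bpoly_rank def_r Bpoly_lastS -def_r /Bpoly_last.
under [RHS]eq_bigr do rewrite big_distrr.
rewrite (exchange_big_dep xpredT) //=; apply: eq_bigr => w _.
have [s def_s] := letter_val_rank (w.1 ord_max) (w.2 ord_max).
rewrite (big_pred1 s) => [|i]; last first.
  by rewrite sperm_val_max def_s (inj_eq (@rank_val_inj _)) eq_sym.
by rewrite sperm_val_max def_s (rank_val_lt_bumpz _ (esym def_r)).
Qed.

Lemma Bpoly_last1 b : Bpoly_last 1 (letter_val b 0) = 'X^b.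
Proof.
rewrite (Bpoly_lastS ord0) (big_pred1 (1%g, [ffun=> false])) /=; last first.
  move=> [s e]; apply/esym/eqP; congr pair; first by apply/permP => -[].
  by apply/ffunP => -[].
have -> : ord_max = ord0 :> 'I_1 by apply: val_inj.
by rewrite sperm_val0 des_sum big_ord0 mulr1; case: b.
Qed.

Lemma Bpoly_rank1_0 : Bpoly_rank 1 0 = 'X.
Proof. exact: (Bpoly_last1 true). Qed.

Lemma Bpoly_rank1_1 : Bpoly_rank 1 1 = 1.
Proof. exact: (Bpoly_last1 false). Qed.
End LastLetter.

Section AlternatingIncrease.
Local Open Scope ring_scope.
Implicit Types (d n r : nat) (x k : int).

(* The coefficients of all the [Bpoly_rank d r] in one sequence, ordered by
   degree and then by rank. *)
Definition Bcoef d x : int :=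
  if x is Posz n then (Bpoly_rank d (n %% d.*2))`_(n %/ d.*2) else 0.

Lemma BcoefE d r (k : nat) : (r < d.*2)%N ->
  Bcoef d (k%:Z * d.*2%:Z + r%:Z) = (Bpoly_rank d r)`_k.
Proof.
move=> lt_r; rewrite -PoszM -PoszD /= modnMDl divnMDl; last by lia.
by rewrite modn_small ?divn_small ?addn0.
Qed.

Lemma Bcoef_lt0 d x : x < 0 -> Bcoef d x = 0.
Proof. by case: x. Qed.

Lemma exists_edivz n x : (0 < n)%N ->
  exists k r, (r < n)%N /\ x = k * n%:Z + r%:Z.
Proof.
move=> n_gt0; exists (x %/ n%:Z)%Z, (absz (x %% n%:Z)%Z).
have r_ge0 : 0 <= (x %% n%:Z)%Z by apply: modz_ge0; lia.
have r_lt : (x %% n%:Z)%Z < n%:Z by apply: ltz_pmod.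
by split; [lia | rewrite gez0_abs // -divz_eq].
Qed.

Lemma stutter_block d r k : (r < d.+1.*2)%N ->
  stutter d.+1 (k * d.+1.*2%:Z + r%:Z) = k * d.*2%:Z + (rank_shift d r)%:Z.
Proof.
move=> lt_r; rewrite /stutter /rank_shift.
have -> : k * d.+1.*2%:Z + r%:Z =
    (2 * k + (d < r)%N%:Z) * d.+1%:Z + (r - (d < r) * d.+1)%N%:Z by nia.
rewrite divzMDl // [((r - _)%N%:Z %/ _)%Z]divz_small; nia.
Qed.

Lemma BcoefS d x : (0 < d)%N ->
  Bcoef d.+1 x = window_sum d.*2 (Bcoef d) (stutter d.+1 x).
Proof.
move=> d_gt0; have [k [r [lt_r ->]]] := @exists_edivz d.+1.*2 x isT.
rewrite stutter_block // window_sum_split ?rank_shift_le //.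
have [k_lt0|] := ltrP k 0.
  rewrite Bcoef_lt0 ?big1 //; last by nia.
  by move=> s _; rewrite Bcoef_lt0 //; have := ltn_ord s; nia.
case: k => // k _; rewrite BcoefE // Bpoly_rankS // coef_sum.
apply: eq_bigr => s _; case: leqP => _.
  rewrite expr1 coefXM mul1n; case: k => [|k] /=.
    by rewrite Bcoef_lt0 //; have := ltn_ord s; lia.
  by rewrite -BcoefE //; congr Bcoef; lia.
by rewrite expr0 mul1r subr0 BcoefE.
Qed.

Lemma Bcoef1 x : Bcoef 1 x = ((x == 1) || (x == 2))%:R.
Proof.
case: x => [[|[|[|[|n]]]]|n] //=;
  rewrite ?Bpoly_rank1_0 ?Bpoly_rank1_1 ?coefX ?coef1 //.
have -> : (n.+4 %/ 1.*2 = (n %/ 2).+2)%N by lia.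
have : (n.+4 %% 1.*2 < 2)%N by lia.
by case: (_ %% _)%N => [|[|//]] _;
  rewrite ?Bpoly_rank1_0 ?Bpoly_rank1_1 ?coefX ?coef1.
Qed.

Lemma symmetric_unimodal_Bcoef d : (0 < d)%N ->
  symmetric_unimodal ((d.*2 * d.+1)%N%:Z - 1) (Bcoef d).
Proof.
case: d => // d _; elim: d => [|d IHd].
  split=> [x|x y]; rewrite !Bcoef1; first by congr (nat_of_bool _)%:R; lia.
  by case: eqP; case: eqP; case: eqP; case: eqP; lia.
pose j : int := d.+3.*2%:Z.
apply: (eq_symmetric_unimodal (fun x => esym (@BcoefS d.+1 x isT))).
have -> : (d.+2.*2 * d.+3)%N%:Z - 1 = j * d.+2%:Z - 1 by rewrite /j; lia.
apply: symmetric_unimodal_stutter => //.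
have -> : j * (d.+2%:Z - 1) = (d.+1.*2 * d.+2)%N%:Z - 1 + d.+1.*2%:Z + 1.
  by rewrite /j; lia.
exact: symmetric_unimodal_window_sum.
Qed.

Lemma alternatingly_increasing_Bpoly_rank d r :
  (d <= r < d.*2)%N -> alternatingly_increasing (Bpoly_rank d r).
Proof.
move=> dr; rewrite /alternatingly_increasing size_Bpoly_rank // => j lt_j.
have /andP[le_r lt_r] := dr; have d_gt0 : (0 < d)%N by lia.
have [Bsym Bmono] := symmetric_unimodal_Bcoef d_gt0.
rewrite /alt_index /= uphalf_half; case: (boolP (odd j)) => odd_j /=.
  by rewrite -!BcoefE // -Bsym; apply: Bmono; nia.
by rewrite -!BcoefE //; apply: Bmono; nia.
Qed.
End AlternatingIncrease.

Section DerivativeRecurrences.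
Local Open Scope ring_scope.
Implicit Types (d r : nat).

Lemma Bpoly_rank_bottom d : (0 < d)%N ->
  Bpoly_rank d.+1 0 = 'X * \sum_(s < d.*2) Bpoly_rank d s.
Proof. by move=> d_gt0; rewrite Bpoly_rankS // big_distrr. Qed.

Lemma Bpoly_rank_top d : (0 < d)%N ->
  Bpoly_rank d.+1 d.*2.+1 = \sum_(s < d.*2) Bpoly_rank d s.
Proof.
move=> d_gt0; rewrite Bpoly_rankS ?doubleS //; apply: eq_bigr => s _.
have lt_s : (s < rank_shift d d.*2.+1)%N.
  by have := ltn_ord s; rewrite /rank_shift; lia.
by rewrite leqNgt lt_s expr0 mul1r.
Qed.

Lemma sum_mul_Bpoly_rankS d (e : nat -> {poly int}) : (0 < d)%N ->
  \sum_(s < d.+1.*2) e s * Bpoly_rank d.+1 s =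
  \sum_(s < d.*2) ((e 0 * 'X + e d.*2.+1) * Bpoly_rank d s +
                   e s.+1 * Bpoly_rank d.+1 s.+1).
Proof.
move=> d_gt0; rewrite doubleS big_ord_recl big_ord_recr /= /bump add1n.
rewrite Bpoly_rank_bottom // Bpoly_rank_top // mulrA big_split -big_distrr /=.
by rewrite mulrDl -addrA [X in _ + X]addrC.
Qed.

Lemma Bpoly_rank_deriv d r : (0 < d)%N -> (r < d.*2)%N ->
  Bpoly_rank d.+1 r.+1 =
  2%:R * 'X * ((1 - 'X) * (Bpoly_rank d r)^`() + d%:R * Bpoly_rank d r).
Proof.
case: d => // d _; elim: d r => [|d IHd] r lt_r.
  rewrite Bpoly_rankS //; last by lia.
  rewrite !big_ord_recl big_ord0 /= Bpoly_rank1_0 Bpoly_rank1_1.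
  by case: r lt_r => [|[|//]] _;
    rewrite ?Bpoly_rank1_0 ?Bpoly_rank1_1 derivE /=; ring.
have shift_rS : rank_shift d.+2 r.+1 = (rank_shift d.+1 r).+1.
  by rewrite /rank_shift; lia.
have shift_r_le : (rank_shift d.+1 r < d.+1.*2.+1)%N by apply: rank_shift_le.
rewrite Bpoly_rankS //; last by lia.
rewrite (sum_mul_Bpoly_rankS (fun s => 'X^(rank_shift d.+2 r.+1 <= s))) //.
rewrite shift_rS shift_r_le ltn0 expr0 expr1.
rewrite Bpoly_rankS // raddf_sum /= !big_distrr /= -!big_split /= big_distrr /=.
apply: eq_bigr => s _; rewrite ltnS IHd // derivM -[d.+2]addn1 natrD.
move: (Bpoly_rank d.+1 s) (Bpoly_rank d.+1 s)^`() (d.+1%:R) => b b' n.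
by case: leqP => _; rewrite ?expr0 ?expr1 derivE; ring.
Qed.

Lemma Bpoly_rank_top_deriv d :
  let S := Bpoly_rank d.+1 d.*2.+1 in
  Bpoly_rank d.+2 d.*2.+3 =
  2%:R * 'X * (1 - 'X) * S^`() + (d.*2%:R * 'X + 1 + 'X) * S.
Proof.
rewrite -doubleS (@Bpoly_rank_top d.+1) //; case: d => [|d] /=.
  rewrite !big_ord_recl big_ord0 /= Bpoly_rank1_0 Bpoly_rank1_1 derivE double0.
  by ring.
under eq_bigr do rewrite -[Bpoly_rank _ _]mul1r.
rewrite (sum_mul_Bpoly_rankS (fun=> 1)) // Bpoly_rank_top //.
rewrite raddf_sum /= !big_distrr /= -!big_split /=; apply: eq_bigr => s _.
have -> : d.+1.*2%:R = d.+1%:R * 2%:R :> {poly int} by rewrite -muln2 natrM.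
rewrite Bpoly_rank_deriv //.
by move: (Bpoly_rank d.+1 s) (Bpoly_rank d.+1 s)^`() (d.+1%:R) => b b' n; ring.
Qed.
End DerivativeRecurrences.

Section RealRoots.
Local Open Scope ring_scope.
Variable R : rcfType.
Implicit Types (d r : nat).

Local Notation BpolyR d r := (map_poly intr (Bpoly_rank d r) : {poly R}).

Lemma size_BpolyR d r : (d <= r < d.*2)%N -> size (BpolyR d r) = d.
Proof.
by move=> dr; rewrite size_map_inj_poly ?size_Bpoly_rank //; apply: intr_inj.
Qed.

Lemma lead_coef_BpolyR_gt0 d r :
  (d <= r < d.*2)%N -> 0 < lead_coef (BpolyR d r).
Proof.
move=> dr; rewrite lead_coef_map_inj //; last exact: intr_inj.
by rewrite ltr0z lead_coef_Bpoly_rank_gt0.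
Qed.

Lemma BpolyR_deriv d r : (0 < d)%N -> (r < d.*2)%N ->
  BpolyR d.+1 r.+1 =
  2%:R *: (((1 - 'X) * (BpolyR d r)^`() + d%:R * BpolyR d r) * 'X).
Proof.
move=> d_gt0 lt_r; rewrite Bpoly_rank_deriv // deriv_map.
rewrite !(rmorphD, rmorphM, rmorphN, rmorph1, rmorph_nat) /= map_polyX.
by rewrite scaler_nat -mulr_natl; ring.
Qed.

Lemma BpolyR_top_deriv d :
  BpolyR d.+2 d.*2.+3 =
  2%:R * 'X * (1 - 'X) * (BpolyR d.+1 d.*2.+1)^`() +
  (d.*2%:R * 'X + 1 + 'X) * BpolyR d.+1 d.*2.+1.
Proof.
rewrite Bpoly_rank_top_deriv deriv_map.
by rewrite !(rmorphD, rmorphM, rmorphN, rmorph1, rmorph_nat) /= map_polyX.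
Qed.

Lemma BpolyR_top_simply_split d : simply_split (< 0) (BpolyR d.+1 d.*2.+1).
Proof.
elim: d => [|d IHd].
  exists [::]; split=> //.
  by rewrite Bpoly_rank1_1 rmorph1 big_nil lead_coef1 scale1r.
set S := BpolyR _ _ in IHd.
have rank_top : (d.+1 <= d.*2.+1 < d.+1.*2)%N by lia.
have lc_S : 0 < lead_coef S by apply: lead_coef_BpolyR_gt0.
have S_neq0 : S != 0 by rewrite -lead_coef_eq0 gt_eqF.
apply: (@simply_split_deriv_sgr _ (S * 'X)).
- by have := simply_split_mul_XsubC IHd; rewrite subr0.
- by rewrite lead_coefMX.
- by apply: lead_coef_BpolyR_gt0; lia.
- by rewrite size_mulX // !size_BpolyR //; lia.
rewrite doubleS BpolyR_top_deriv -/S => r; rewrite rootM rootX => root_r _.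
have [->|r_neq0] := eqVneq r 0; first by congr Num.sg; rewrite !derivE !hornerE.
move: root_r; rewrite (negPf r_neq0) orbF => root_r.
have r_lt0 := root_simply_split S_neq0 IHd root_r.
have -> : (2%:R * 'X * (1 - 'X) * S^`() + (d.*2%:R * 'X + 1 + 'X) * S).[r] =
          (2%:R * (1 - r)) * (S * 'X)^`().[r].
  by rewrite derivM derivX !hornerE /= (rootP root_r); ring.
by rewrite sgrM gtr0_sg ?mul1r // mulr_gt0 // subr_gt0 (lt_trans r_lt0).
Qed.

Lemma BpolyR_simply_splitS d r : (d <= r < d.*2)%N ->
  simply_split (<= 0) (BpolyR d r) -> simply_split (<= 0) (BpolyR d.+1 r.+1).
Proof.
move=> dr split_p; have d_gt0 : (0 < d)%N by lia.
have /andP[_ lt_r] := dr.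
have drS : (d.+1 <= r.+1 < d.+1.*2)%N by lia.
have := lead_coef_BpolyR_gt0 drS; have := size_BpolyR drS.
rewrite BpolyR_deriv //; set p := BpolyR d r; set q := _ + _.
have two_neq0 : 2%:R != 0 :> R by rewrite pnatr_eq0.
rewrite lead_coefZ lead_coefMX pmulr_rgt0 // size_scale // => size_qX lc_q.
have q_neq0 : q != 0 by rewrite -lead_coef_eq0 gt_eqF.
apply: simply_splitZ => //.
have -> : 'X = 'X - 0%:P :> {poly R} by rewrite subr0.
apply: simply_split_mul_XsubC; apply: (simply_split_deriv_sgr split_p) => //.
- exact: lead_coef_BpolyR_gt0.
- by move: size_qX; rewrite size_mulX // size_BpolyR // => -[].
move=> r0 /rootP p_r0 r0_le0; rewrite !hornerE /= -/p p_r0 mulr0 addr0 sgrM.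
by rewrite gtr0_sg ?mul1r // subr_gt0 (le_lt_trans r0_le0).
Qed.

Lemma BpolyR_simply_split d r :
  (d <= r < d.*2)%N -> simply_split (<= 0) (BpolyR d r).
Proof.
elim: d r => // d IHd [//|r] dr.
have [r_top|lt_r] := eqVneq r.+1 d.*2.+1; last first.
  by apply: BpolyR_simply_splitS; [|apply: IHd]; lia.
by rewrite r_top; apply: simply_split_sub (BpolyR_top_simply_split d) => x /ltW.
Qed.
End RealRoots.

Lemma Bpoly_rank_real_rooted (d r : nat) :
  d <= r < d.*2 -> real_rooted (Bpoly_rank d r).
Proof.
move=> dr R z; have split_p := BpolyR_simply_split R dr.
have -> : map_poly intr (Bpoly_rank d r) =
          map_poly (real_complex R) (map_poly intr (Bpoly_rank d r)).
  by rewrite -map_poly_comp; apply: eq_map_poly => x /=; rewrite rmorph_int.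
apply: simply_split_complex_root split_p.
by rewrite -lead_coef_eq0 gt_eqF // lead_coef_BpolyR_gt0.
Qed.

Theorem theorem3p9 (d l : nat) (hd : 1 <= d) (hl : 1 <= l <= d) :
  real_rooted (Bpoly l d) /\ alternatingly_increasing (Bpoly l d).
Proof.
have dr : d <= d.*2 - l < d.*2 by lia.
rewrite Bpoly_rankE //; split; first exact: Bpoly_rank_real_rooted.
exact: alternatingly_increasing_Bpoly_rank.
Qed.
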